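(* Let $n \geqslant 1$ be an integer, let $\Lambda$ be a weakly $n$-representation finite algebra with $\operatorname{gldim}(\Lambda) \leqslant n$, and let $\mathcal{M}(\Lambda)$ be the associated $n$-abelian category. Let $t$ be an $n$-APR tilting module for $\Lambda$. Then $\mathcal{M}(\Lambda) \cap \operatorname{Fac}(t)$ is a splitting torsion class in $\mathcal{M}(\Lambda)$.
   Context: Conventions: full subcategories are closed under isomorphism. $\operatorname{add}$ of a class of objects is the full subcategory of direct summands of finite direct sums of objects in the class. **Setting.** $k$ is an algebraically closed field, $\Lambda$ is a finite dimensional $k$-algebra, $\mathsf{mod}(\Lambda)$ is the category of finitely generated left $\Lambda$-modules. A full subcategory $\mathcal{T} \subseteq \mathsf{mod}(\Lambda)$ is $n$-cluster tilting if it is functorially finite, generating and cogenerating (each module $d$ permits an epimorphism $t_0 \to d$ and a monomorphism $d \to t_1$ with $t_0,t_1\in\mathcal{T}$), and $\mathcal{T} = \{ d \mid \operatorname{Ext}^i_\Lambda(\mathcal{T},d)=0 \text{ for } 1 \leqslant i \leqslant n-1\} = \{ d \mid \operatorname{Ext}^i_\Lambda(d,\mathcal{T})=0 \text{ for } 1 \leqslant i \leqslant n-1\}$. $\Lambda$ is weakly $n$-representation finite if there is $M \in \mathsf{mod}(\Lambda)$ with $\operatorname{add}(M)$ $n$-cluster tilting. It is assumed that $\Lambda$ (as a left module) and $M$ are basic (no repeated direct summands); $M$ is then unique. Set $\mathcal{M} = \mathcal{M}(\Lambda) = \operatorname{add}(M) \subseteq \mathsf{mod}(\Lambda)$; $\mathcal{M}(-,-)$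 denotes its morphism spaces. **$n$-APR tilting module.** Let $p$ be a simple projective, non-injective left $\Lambda$-module and write $\Lambda = p \oplus q$ as left $\Lambda$-modules. The corresponding $n$-APR tilting module is $t = (\tau_n^- p) \oplus q$, where $\tau_n^- = \operatorname{Tr}\,\Omega^{n-1}\,\mathrm{D}$ is the composition of $k$-linear duality $\mathrm{D}$, the $(n-1)$st syzygy $\Omega^{n-1}$ in a minimal projective resolution, and the Auslander–Bridger transpose $\operatorname{Tr}$ (defined as the cokernel of the $\Lambda$-dual of a minimal projective presentation). **$\operatorname{Fac}(t)$** is the class of quotients in $\mathsf{mod}(\Lambda)$ of modules of the form $t^{\oplus d}$. **$n$-exact sequence** in $\mathcal{M}$: a sequence $0 \to m_{n+1} \to m_n \to \cdots \to m_1 \to m_0 \to 0$ in $\mathcal{M}$ such that for each $m \in \mathcal{M}$ the induced sequences $0 \to \mathcal{M}(m,m_{n+1}) \to \cdots \to \mathcal{M}(m,m_1)\to\mathcal{M}(m,m_0)$ and $0 \to \mathcal{M}(m_0,m) \to \cdots \to \mathcal{M}(m_n,m)\to\mathcal{M}(m_{n+1},m)$ are exact. **$\mathcal{U}$-exact**, for a full subcategory $\mathcal{U} \subseteq \mathcal{M}$: the class of complexes $v^1 \to \cdots \to v^n$ in $\mathcal{M}$ such that $0 \to \mathcal{M}(u,v^1) \to \cdots \to \mathcal{M}(u,v^n) \to 0$ is exact for each $u \in \mathcal{U}$. **Torsion class** in $\mathcal{M}$: a full subcategory $\mathcal{U}$ such that for each $m \in \mathcal{M}$ there is an $n$-exact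 sequence $0 \to u \xrightarrow{\theta} m \to v^1 \to \cdots \to v^n \to 0$ in $\mathcal{M}$ with $u \in \mathcal{U}$ and $v^1 \to \cdots \to v^n$ in the class $\mathcal{U}$-exact. It is **splitting** if, for each $m$, the sequence can be chosen with $\theta$ a split monomorphism. *)

(* Defs.v *)
From HB Require Import structures.
From mathcomp Require Import all_boot all_order all_algebra all_field.
From mathcomp Require Import boolp.

Set Implicit Arguments.
Unset Strict Implicit.
Unset Printing Implicit Defensive.

Import GRing.Theory.
Local Open Scope ring_scope.

(** * Modules over a ring

    Left [R]-modules are [lmodType R]; right [R]-modules are [lmodType R^c],
    where [R^c] is the opposite ring. *)

Definition finitely_generated (R : nzRingType) (M : lmodType R) : Prop :=
  exists (m : nat) (g : 'I_m -> M),
    forall x, exists c : 'I_m -> R, x = \sum_i c i *: g i.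

Record fgmod (R : nzRingType) := FGMod {
  fgmod_sort :> lmodType R;
  fgmod_fg : finitely_generated fgmod_sort
}.

Section Modules.
Variable R : nzRingType.
Implicit Types M N C X Y P E : lmodType R.

Definition surjective (A B : Type) (f : A -> B) : Prop :=
  forall y, exists x, f x = y.

Definition exact (A B : Type) (C : zmodType) (f : A -> B) (g : B -> C) : Prop :=
  forall y, g y = 0 <-> exists x, y = f x.

Definition zero_module M : Prop := forall x : M, x = 0.

Definition isomorphic M N : Prop := exists f : {linear M -> N}, bijective f.

Definition direct_summand N M : Prop :=
  exists N' : lmodType R, isomorphic M (N * N')%type.

(* No nonzero module occurs twice in a direct sum decomposition. *)
Definition basic M : Prop :=
  forall X, direct_summand (X * X)%type M -> zero_module X.

Definition simple_module M : Prop :=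
  ~ zero_module M /\
  forall S : {pred M}, submod_closed S -> S =i pred1 0 \/ S =i predT.

Definition projective P : Prop :=
  forall M N (e : {linear M -> N}) (f : {linear P -> N}),
    surjective e -> exists g : {linear P -> M}, forall x, e (g x) = f x.

Definition injective_module E : Prop :=
  forall M N (i : {linear M -> N}) (f : {linear M -> E}),
    injective i -> exists g : {linear N -> E}, forall x, g (i x) = f x.

(* The kernel K of [f : M -> N] is superfluous: if S is a submodule with
   S + K = M, then S = M. *)
Definition superfluous_kernel M (N : lmodType R) (f : {linear M -> N}) : Prop :=
  forall S : {pred M}, submod_closed S ->
    (forall x, exists y z, [/\ y \in S, f z = 0 & x = y + z]) -> S =i predT.

Definition is_cokernel M N C (f : {linear M -> N}) (c : {linear N -> C}) : Prop :=
  surjective c /\ exact f c.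

(** ** Projective resolutions by finitely generated modules *)

Record resolution M := Resolution {
  res_ob :> nat -> fgmod R;
  res_d : forall i, {linear res_ob i.+1 -> res_ob i};
  res_aug : {linear res_ob 0%N -> M};
  res_projective : forall i, projective (res_ob i);
  res_aug_surj : surjective res_aug;
  res_exact0 : exact (res_d 0%N) res_aug;
  res_exact : forall i, exact (res_d i.+1) (res_d i)
}.

Definition minimal_resolution M (P : resolution M) : Prop :=
  superfluous_kernel (res_aug P) /\
  forall i, superfluous_kernel (res_d P i).

Definition is_syzygy (i : nat) M Y : Prop :=
  match i with
  | 0 => isomorphic M Y
  | j.+1 => exists (P : resolution M) (s : {linear Y -> P j}),
      [/\ minimal_resolution P, injective s
        & forall y, (exists x, y = s x) <-> (exists x, y = res_d P j x)]
  end.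

Definition minimal_projective_presentation (P1 P0 : fgmod R) M
    (d : {linear P1 -> P0}) (e : {linear P0 -> M}) : Prop :=
  [/\ projective P1, projective P0, is_cokernel d e,
      superfluous_kernel e & superfluous_kernel d].

(* [Ext^i(M, N) = 0]: the cohomology at [Hom(P_i, N)] of [Hom(P, N)] vanishes
   for a projective resolution P of M; this does not depend on P. *)
Definition Ext_vanishes (i : nat) M N : Prop :=
  exists P : resolution M,
    match i with
    | 0 => forall f : {linear P 0%N -> N},
        (forall x, f (res_d P 0 x) = 0) -> forall x, f x = 0
    | j.+1 => forall f : {linear P j.+1 -> N},
        (forall x, f (res_d P j.+1 x) = 0) ->
        exists g : {linear P j -> N}, forall x, f x = g (res_d P j x)
    end.

Definition gldim_le (n : nat) : Prop :=
  forall M : fgmod R, exists P : resolution M,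
    forall i, (n < i)%N -> zero_module (P i).

End Modules.

(** * Full subcategories of finitely generated modules *)

Section Subcategories.
Variable R : nzRingType.
Implicit Types (T U : fgmod R -> Prop) (n : nat).

Definition iso_closed T : Prop :=
  forall x y : fgmod R, isomorphic x y -> T x -> T y.

Definition add_closure (M x : fgmod R) : Prop :=
  exists d : nat, direct_summand x {ffun 'I_d -> M}.

Definition Fac (t x : fgmod R) : Prop :=
  exists (d : nat) (f : {linear {ffun 'I_d -> t} -> x}), surjective f.

Definition contravariantly_finite T : Prop :=
  forall d : fgmod R, exists (t : fgmod R) (f : {linear t -> d}), T t /\
    forall (t' : fgmod R) (f' : {linear t' -> d}), T t' ->
      exists g : {linear t' -> t}, forall x, f' x = f (g x).

Definition covariantly_finite T : Prop :=
  forall d : fgmod R, exists (t : fgmod R) (f : {linear d -> t}), T t /\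
    forall (t' : fgmod R) (f' : {linear d -> t'}), T t' ->
      exists g : {linear t -> t'}, forall x, f' x = g (f x).

Definition functorially_finite T : Prop :=
  contravariantly_finite T /\ covariantly_finite T.

Definition generating T : Prop :=
  forall d : fgmod R, exists (t : fgmod R) (f : {linear t -> d}),
    T t /\ surjective f.

Definition cogenerating T : Prop :=
  forall d : fgmod R, exists (t : fgmod R) (f : {linear d -> t}),
    T t /\ injective f.

Record n_cluster_tilting n T : Prop := {
  nct_iso : iso_closed T;
  nct_finite : functorially_finite T;
  nct_generating : generating T;
  nct_cogenerating : cogenerating T;
  nct_right : forall d : fgmod R, T d <->
    forall (i : nat) (t : fgmod R), (1 <= i < n)%N -> T t -> Ext_vanishes i t d;
  nct_left : forall d : fgmod R, T d <->
    forall (i : nat) (t : fgmod R), (1 <= i < n)%N -> T t -> Ext_vanishes i d t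
}.

(** ** Finite sequences of morphisms

    A sequence [x_0 -> x_1 -> ... -> x_k] is given by an infinite one, of which
    only the first terms matter; indices increase along the arrows. *)

Record mseq := MSeq {
  mseq_ob :> nat -> fgmod R;
  mseq_d : forall i, {linear mseq_ob i -> mseq_ob i.+1}
}.

Definition mseq_cons (x : fgmod R) (s : mseq) (f : {linear x -> s 0%N}) : mseq :=
  let ob i := if i is j.+1 then s j else x in
  @MSeq ob (fun i => match i return {linear ob i -> ob i.+1} with
                     | 0 => f
                     | j.+1 => mseq_d s j
                     end).

(* [0 -> s_0 -> s_1 -> ... -> s_n -> s_(n+1) -> 0] is n-exact in T. *)
Record n_exact n T (s : mseq) : Prop := {
  nex_ob : forall i, (i <= n.+1)%N -> T (s i);
  nex_inj : forall m : fgmod R, T m -> forall f : {linear m -> s 0%N},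
    (forall x, mseq_d s 0 (f x) = 0) -> forall x, f x = 0;
  nex_exact_from : forall m : fgmod R, T m ->
    forall i, (i < n)%N -> forall f : {linear m -> s i.+1},
    (forall x, mseq_d s i.+1 (f x) = 0) <->
    exists g : {linear m -> s i}, forall x, f x = mseq_d s i (g x);
  nex_surj : forall m : fgmod R, T m -> forall f : {linear s n.+1 -> m},
    (forall x, f (mseq_d s n x) = 0) -> forall x, f x = 0;
  nex_exact_to : forall m : fgmod R, T m ->
    forall i, (i < n)%N -> forall f : {linear s i.+1 -> m},
    (forall x, f (mseq_d s i x) = 0) <->
    exists g : {linear s i.+2 -> m}, forall x, f x = g (mseq_d s i.+1 x)
}.

(* The complex [v_0 -> ... -> v_(n-1)] in T (that is, [v^1 -> ... -> v^n]) is
   such that [0 -> Hom(u, v_0) -> ... -> Hom(u, v_(n-1)) -> 0] is exact for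
   each u in U. At the last term the kernel condition is void, so for [n = 1]
   the clause [uex_first] says that [Hom(u, v_0) = 0]. *)
Record U_exact n T U (v : mseq) : Prop := {
  uex_ob : forall i, (i < n)%N -> T (v i);
  uex_complex : forall i, (i.+2 < n)%N ->
    forall x, mseq_d v i.+1 (mseq_d v i x) = 0;
  uex_first : forall u : fgmod R, U u -> forall f : {linear u -> v 0%N},
    ((1 < n)%N -> forall x, mseq_d v 0 (f x) = 0) -> forall x, f x = 0;
  uex_next : forall u : fgmod R, U u ->
    forall i, (i.+1 < n)%N -> forall f : {linear u -> v i.+1},
    ((i.+2 < n)%N -> forall x, mseq_d v i.+1 (f x) = 0) ->
    exists g : {linear u -> v i}, forall x, f x = mseq_d v i (g x)
}.

(* [0 -> u -> m -> v^1 -> ... -> v^n -> 0] with first map [theta]. *)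
Definition torsion_sequence n T U (m u : fgmod R) (theta : {linear u -> m}) :
    Prop :=
  exists (v : mseq) (f : {linear m -> v 0%N}),
    [/\ U u, U_exact n T U v
      & n_exact n T (@mseq_cons u (mseq_cons f) theta)].

Definition split_mono (M N : lmodType R) (f : {linear M -> N}) : Prop :=
  exists r : {linear N -> M}, forall x, r (f x) = x.

Record torsion_class n T U : Prop := {
  tors_iso : iso_closed U;
  tors_sub : forall x, U x -> T x;
  tors_seq : forall m, T m ->
    exists (u : fgmod R) (theta : {linear u -> m}), torsion_sequence n T U theta
}.

Definition splitting_torsion_class n T U : Prop :=
  torsion_class n T U /\
  forall m, T m -> exists (u : fgmod R) (theta : {linear u -> m}),
    torsion_sequence n T U theta /\ split_mono theta.

End Subcategories.

(** * Groups of linear maps *)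

Section LinHom.
Variables (R : nzRingType) (M N : lmodType R).

Definition lin_hom := {linear M -> N}.
HB.instance Definition _ := gen_eqMixin lin_hom.
HB.instance Definition _ := gen_choiceMixin lin_hom.

Implicit Types f g h : lin_hom.

Lemma lin_homP f g : f =1 g -> f = g.
Proof.
case: f g => [f cf] [g cg] /= /funext fg; subst g; congr GRing.Linear.Pack.
case: cf cg => [[a] [b]] [[a'] [b']].
by rewrite (Prop_irrelevance a a') (Prop_irrelevance b b').
Qed.

Definition lin_hom_zero : lin_hom := (\0 : {linear M -> N}).
Definition lin_hom_add f g : lin_hom := (f \+ g : {linear M -> N}).
Definition lin_hom_opp f : lin_hom := (\- f : {linear M -> N}).

Fact lin_hom_addA : associative lin_hom_add.
Proof. by move=> f g h; apply: lin_homP => x /=; rewrite addrA. Qed.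
Fact lin_hom_addC : commutative lin_hom_add.
Proof. by move=> f g; apply: lin_homP => x /=; rewrite addrC. Qed.
Fact lin_hom_add0 : left_id lin_hom_zero lin_hom_add.
Proof. by move=> f; apply: lin_homP => x /=; rewrite add0r. Qed.
Fact lin_hom_addN : left_inverse lin_hom_zero lin_hom_opp lin_hom_add.
Proof. by move=> f; apply: lin_homP => x /=; rewrite addNr. Qed.

HB.instance Definition _ := GRing.isZmodule.Build lin_hom
  lin_hom_addA lin_hom_addC lin_hom_add0 lin_hom_addN.

End LinHom.

(** * The dual [Hom(P, R)] of a right module P, as a left module *)

Section RingDual.
Variables (R : nzRingType) (P : lmodType R^c).

Definition ring_dual := lin_hom P (R^c)^o.
HB.instance Definition _ := GRing.Zmodule.on ring_dual.

Section Scale.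
Variables (a : R) (f : ring_dual).

Definition ring_dual_scale_fun (x : P) : (R^c)^o := a * (f x : R).

Fact ring_dual_scale_linear : linear ring_dual_scale_fun.
Proof.
move=> b x y; rewrite /ring_dual_scale_fun linearP [LHS]mulrDr.
by congr (_ + _); exact: (@mulrA R a (f x) b).
Qed.
HB.instance Definition _ := GRing.isLinear.Build R^c P (R^c)^o *:%R
  ring_dual_scale_fun ring_dual_scale_linear.

Definition ring_dual_scale : ring_dual :=
  (ring_dual_scale_fun : {linear P -> (R^c)^o}).
End Scale.

Fact ring_dual_scaleA a b f :
  ring_dual_scale a (ring_dual_scale b f) = ring_dual_scale (a * b) f.
Proof. by apply: lin_homP => x; exact: (@mulrA R a b (f x)). Qed.
Fact ring_dual_scale1 : left_id 1 ring_dual_scale.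
Proof. by move=> f; apply: lin_homP => x; exact: (@mul1r R (f x)). Qed.
Fact ring_dual_scaleDr : right_distributive ring_dual_scale +%R.
Proof. by move=> a f g; apply: lin_homP => x; exact: (@mulrDr R a (f x) (g x)). Qed.
Fact ring_dual_scaleDl f : {morph ring_dual_scale^~ f : a b / a + b}.
Proof. by move=> a b; apply: lin_homP => x; exact: (@mulrDl R a b (f x)). Qed.

HB.instance Definition _ := GRing.Zmodule_isLmodule.Build R ring_dual
  ring_dual_scaleA ring_dual_scale1 ring_dual_scaleDr ring_dual_scaleDl.

End RingDual.

Section RingDualMap.
Variables (R : nzRingType) (P Q : lmodType R^c) (g : {linear P -> Q}).

Definition ring_dual_map (f : ring_dual Q) : ring_dual P :=
  (f \o g : {linear P -> (R^c)^o}).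

Fact ring_dual_map_linear : linear ring_dual_map.
Proof. by move=> a f h; apply: lin_homP. Qed.
HB.instance Definition _ := GRing.isLinear.Build R (ring_dual Q) (ring_dual P)
  *:%R ring_dual_map ring_dual_map_linear.

End RingDualMap.

(* Y is the Auslander-Bridger transpose of the right module X. *)
Definition is_transpose (R : nzRingType) (X : lmodType R^c) (Y : lmodType R) :
    Prop :=
  exists (P1 P0 : fgmod R^c) (d : {linear P1 -> P0}) (e : {linear P0 -> X})
         (c : {linear ring_dual P1 -> Y}),
    minimal_projective_presentation d e /\ is_cokernel (ring_dual_map d) c.

(** * Modules over a finite dimensional algebra *)

Section Algebra.
Variables (k : fieldType) (A : falgType k).

(* The underlying k-vector space of an A-module. *)
Section Restriction.
Variable M : lmodType A.

Definition restriction : Type := M.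
HB.instance Definition _ := GRing.Zmodule.on restriction.

Definition restriction_scale (c : k) (x : restriction) : restriction :=
  (c%:A : A) *: (x : M).

Fact restriction_scaleA a b x :
  restriction_scale a (restriction_scale b x) = restriction_scale (a * b) x.
Proof. by rewrite /restriction_scale scalerA -scalerAl mul1r scalerA. Qed.
Fact restriction_scale1 : left_id 1 restriction_scale.
Proof. by move=> x; rewrite /restriction_scale scale1r; exact: scale1r. Qed.
Fact restriction_scaleDr : right_distributive restriction_scale +%R.
Proof. by move=> a x y; exact: scalerDr. Qed.
Fact restriction_scaleDl x : {morph restriction_scale^~ x : a b / a + b}.
Proof. by move=> a b; rewrite /restriction_scale scalerDl; exact: scalerDl. Qed.

HB.instance Definition _ := GRing.Zmodule_isLmodule.Build k restriction
  restriction_scaleA restriction_scale1 restriction_scaleDr restriction_scaleDl.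

End Restriction.

(* The k-linear dual [D M] of a left module M, as a right module with
   [(f . a) x = f (a x)]. *)
Section Duality.
Variable M : lmodType A.

Definition k_dual := lin_hom (restriction M) k^o.
HB.instance Definition _ := GRing.Zmodule.on k_dual.

Fact scaler_algC (a : A) (c : k) (x : M) :
  a *: (c%:A *: x) = c%:A *: (a *: x).
Proof. by rewrite !scalerA -scalerAr -scalerAl mulr1 mul1r. Qed.

Section Scale.
Variables (a : A^c) (f : k_dual).

Definition k_dual_scale_fun (x : restriction M) : k^o :=
  f ((a : A) *: (x : M) : restriction M).

Fact k_dual_scale_linear : linear k_dual_scale_fun.
Proof.
move=> c x y; rewrite /k_dual_scale_fun -linearP; congr (f _).
rewrite [LHS]scalerDr; congr (_ + _).
exact: (@scaler_algC (a : A) c x).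
Qed.
HB.instance Definition _ := GRing.isLinear.Build k (restriction M) k^o *:%R
  k_dual_scale_fun k_dual_scale_linear.

Definition k_dual_scale : k_dual :=
  (k_dual_scale_fun : {linear restriction M -> k^o}).
End Scale.

Fact k_dual_scaleA a b f :
  k_dual_scale a (k_dual_scale b f) = k_dual_scale (a * b) f.
Proof.
by apply: lin_homP => x; rewrite /= /k_dual_scale_fun /= /k_dual_scale_fun
  scalerA.
Qed.
Fact k_dual_scale1 : left_id 1 k_dual_scale.
Proof.
by move=> f; apply: lin_homP => x; rewrite /= /k_dual_scale_fun scale1r.
Qed.
Fact k_dual_scaleDr : right_distributive k_dual_scale +%R.
Proof. by move=> a f g; apply: lin_homP. Qed.
Fact k_dual_scaleDl f : {morph k_dual_scale^~ f : a b / a + b}.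
Proof.
move=> a b; apply: lin_homP => x.
by rewrite /= /k_dual_scale_fun scalerDl; exact: raddfD.
Qed.

HB.instance Definition _ := GRing.Zmodule_isLmodule.Build A^c k_dual
  k_dual_scaleA k_dual_scale1 k_dual_scaleDr k_dual_scaleDl.

End Duality.

(* [x] is [Tr (Omega^(n-1) (D p))]. *)
Definition is_tau_minus (n : nat) (p x : lmodType A) : Prop :=
  exists Y : lmodType A^c, is_syzygy n.-1 (k_dual p) Y /\ is_transpose Y x.

Definition nAPR_tilting (n : nat) (t : fgmod A) : Prop :=
  exists p q x : fgmod A,
    [/\ [/\ simple_module p, projective p & ~ injective_module p],
        isomorphic A^o (p * q)%type,
        is_tau_minus n p x
      & isomorphic t (x * q)%type].

End Algebra.

(* Main.v *)
Require Import Defs.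
From HB Require Import structures.
From mathcomp Require Import all_boot all_order all_algebra all_field.
From mathcomp Require Import boolp.

Set Implicit Arguments.
Unset Strict Implicit.
Unset Printing Implicit Defensive.

Import GRing.Theory.
Local Open Scope ring_scope.

(** Write [A = p * q] as a left module, with [p] simple projective, and let
    [t = x * q] with [x] the transpose of a syzygy.  The theorem rests on two
    facts.

    First, [Hom(t, p) = 0].  A nonzero map to the simple projective [p]
    splits.  Hence [Hom(q, p) = 0] because [A] is basic
    ([basic_Hom_complement]), and [Hom(x, p) = 0] because a transpose, being
    computed from a minimal presentation, has no nonzero projective summand;
    what is needed of this is [transpose_Hom_simple].  So [Hom(u, p ^ a) = 0]
    for every [u] in [Fac(t)] ([Fac_Hom_power]).

    Secondly, every finitely generated module [m] is a direct sum of a quotient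
    [u] of some [q ^ r] and a power [p ^ a]
    ([simple_summand_decomposition]).  Indeed, a generating family of [m]
    exhibits [m] as the sum of the image of a map [q ^ r -> m] and of finitely
    many images of [p]; since [p] is simple, a minimal family of these images
    spans a complement.

    As [q] is a quotient of [t], the summand [u] lies in [Fac(t)]; if [m] is in
    [add(M)], so are [u] and [p ^ a].  Then [0 -> u -> m -> p ^ a -> 0 -> ...]
    is a split n-exact sequence, and its right part is exact under [Hom(u', -)]
    for [u'] in [Fac(t)] by the first fact. *)

(** * Linear maps, submodules and direct summands *)

Section LinearMaps.
Variables (R : nzRingType) (M N : lmodType R).

Definition linear_fun (f : M -> N) & linear f : M -> N := f.
HB.instance Definition _ (f : M -> N) (lf : linear f) :=
  GRing.isLinear.Build R M N *:%R (linear_fun lf) lf.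

(** The bundled linear map on a function that is proved to be linear. *)
Definition linear_map (f : M -> N) (lf : linear f) : {linear M -> N} :=
  linear_fun lf.

End LinearMaps.

Section Submodule.
Variables (R : nzRingType) (M : lmodType R) (S : {pred M}).
Hypothesis submodS : submod_closed S.

(** The predicate [S], tagged with the proof that it is closed so that instance
    inference finds the closure properties. *)
Definition submodule_pred of submod_closed S : {pred M} := S.
HB.instance Definition _ :=
  GRing.isSubmodClosed.Build R M (submodule_pred submodS) submodS.

(** A submodule of [M], given by a predicate, as a module in its own right. *)
Record submodule := Submodule {
  submodule_val :> M;
  submodule_valP : submodule_val \in submodule_pred submodS
}.
HB.instance Definition _ := [isSub for submodule_val].
HB.instance Definition _ := [Choice of submodule by <:].
HB.instance Definition _ := [SubChoice_isSubLmodule of submodule by <:].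

End Submodule.

Section Modules.
Variable R : nzRingType.
Implicit Types M N P X Y : lmodType R.

Lemma linear_comp M N P (f : {linear N -> P}) (g : {linear M -> N}) :
  linear (fun x => f (g x)).
Proof. by move=> a x y; rewrite !linearP. Qed.

Lemma linear_inverse M N (f : {linear M -> N}) (g : N -> M) :
  cancel f g -> cancel g f -> linear g.
Proof. exact: can2_linear. Qed.

Lemma fst_linear M N : linear (fun x : M * N => x.1).
Proof. by []. Qed.

Lemma snd_linear M N : linear (fun x : M * N => x.2).
Proof. by []. Qed.

Lemma inl_linear M N : linear (fun x : M => (x, 0) : M * N).
Proof. by move=> a x y; congr pair; rewrite /= scaler0 addr0. Qed.

Lemma inr_linear M N : linear (fun x : N => (0, x) : M * N).
Proof. by move=> a x y; congr pair; rewrite /= scaler0 addr0. Qed.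

Lemma pair_decomposition M N (x : M * N) : (x.1, 0) + (0, x.2) = x.
Proof. by case: x => y z; congr pair; rewrite /= (addr0, add0r). Qed.

Lemma isomorphic_sym M N : isomorphic M N -> isomorphic N M.
Proof.
case=> f [g fK gK]; exists (linear_map (linear_inverse fK gK)).
by exists f.
Qed.

Lemma isomorphic_trans M N P :
  isomorphic M N -> isomorphic N P -> isomorphic M P.
Proof.
by case=> f bf [g bg]; exists (linear_map (linear_comp g f)); apply: bij_comp.
Qed.

Lemma isomorphic_prod M M' N N' :
  isomorphic M M' -> isomorphic N N' -> isomorphic (M * N)%type (M' * N')%type.
Proof.
case=> f [f' fK f'K] [g [g' gK g'K]].
have lfg : linear (fun x : M * N => (f x.1, g x.2) : M' * N').
  by move=> a x y; congr pair; rewrite /= linearP.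
exists (linear_map lfg), (fun x => (f' x.1, g' x.2)) => -[x y];
  by rewrite /= /linear_fun /= (fK, f'K) (gK, g'K).
Qed.

Lemma isomorphic_prodA M N P :
  isomorphic ((M * N) * P)%type (M * (N * P))%type.
Proof.
have lA : linear (fun x : (M * N) * P => (x.1.1, (x.1.2, x.2)) : M * (N * P)).
  by [].
exists (linear_map lA), (fun x => ((x.1, x.2.1), x.2.2)).
- by case=> [[]].
- by case=> ? [].
Qed.

Lemma isomorphic_prodC M N : isomorphic (M * N)%type (N * M)%type.
Proof.
have lC : linear (fun x : M * N => (x.2, x.1) : N * M) by [].
by exists (linear_map lC), (fun x => (x.2, x.1)); case.
Qed.

Lemma isomorphic_refl M : isomorphic M M.
Proof.
have l1 : linear (fun x : M => x) by [].
by exists (linear_map l1), id.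
Qed.

Lemma direct_summand_trans M N P :
  direct_summand M N -> direct_summand N P -> direct_summand M P.
Proof.
case=> M' NM [N' PN]; exists (M' * N')%type.
apply: (isomorphic_trans PN); apply: isomorphic_trans (isomorphic_prodA _ _ _).
exact: isomorphic_prod (isomorphic_refl _).
Qed.

(** A split epimorphism makes its target a direct summand; the complement is
    the kernel. *)
Lemma split_epi_summand M N (f : {linear M -> N}) (s : {linear N -> M}) :
  cancel s f -> direct_summand N M.
Proof.
move=> sK; pose K : {pred M} := fun x => f x == 0.
have subK : submod_closed K.
  split=> [|a x y]; rewrite /K unfold_in ?linear0 //.
  by move=> /eqP fx /eqP fy; rewrite unfold_in linearP fx fy scaler0 addr0.
have lh : linear (fun x : N * submodule subK => s x.1 + val x.2 : M).
  by move=> a x y /=; rewrite linearP scalerDr addrACA.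
have hK (x : M) : x - s (f x) \in submodule_pred subK.
  by rewrite unfold_in /K linearB sK subrr.
exists (submodule subK); apply: isomorphic_sym.
exists (linear_map lh), (fun x => (f x, Submodule (hK x))).
- case=> x y; rewrite /= /linear_fun /=.
  have fy : f (val y) = 0 by apply/eqP; exact: (valP y).
  have fxy : f (s x + val y) = x by rewrite linearD sK fy addr0.
  by congr pair => //; apply: val_inj; rewrite /= fxy addrC addKr.
- by move=> x; rewrite /= /linear_fun /= addrC subrK.
Qed.

(** The image of a linear map, as a subset. *)
Definition image_pred M N (f : {linear M -> N}) : {pred N} :=
  fun y => `[< exists x, y = f x >].

Lemma image_submod_closed M N (f : {linear M -> N}) :
  submod_closed (image_pred f).
Proof.
split=> [|a y z]; first by apply/asboolP; exists 0; rewrite linear0.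
case/asboolP=> y' -> /asboolP [z' ->].
by apply/asboolP; exists (a *: y' + z'); rewrite linearP.
Qed.

Lemma linear_sum_ffun M X (m : nat) (h : 'I_m -> {linear X -> M}) :
  linear (fun c : {ffun 'I_m -> X} => \sum_i h i (c i)).
Proof.
move=> a c d; rewrite scaler_sumr -big_split; apply: eq_bigr => i _ /=.
by rewrite !ffunE linearP.
Qed.

(** The map from a finite power with the components [h i]. *)
Definition sum_map M X (m : nat) (h : 'I_m -> {linear X -> M}) :
  {linear {ffun 'I_m -> X} -> M} := linear_map (linear_sum_ffun h).

Lemma sum_mapE M X (m : nat) (h : 'I_m -> {linear X -> M}) c :
  sum_map h c = \sum_i h i (c i).
Proof. by []. Qed.

Lemma sum_map_lift M X (m : nat) (h : 'I_m.+1 -> {linear X -> M}) j c :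
  sum_map h c =
  h j (c j) + sum_map (fun i => h (lift j i)) [ffun i => c (lift j i)].
Proof.
rewrite !sum_mapE (bigD1_ord j) //=; congr (_ + _).
by apply: eq_bigr => i _; rewrite ffunE.
Qed.

(** ** Maps into a simple module *)

Lemma simple_surjective M N (f : {linear M -> N}) (x : M) :
  simple_module N -> f x <> 0 -> surjective f.
Proof.
case=> _ simN fx; case: (simN _ (image_submod_closed f)) => eqI y.
  have: f x \in image_pred f by apply/asboolP; exists x.
  by rewrite eqI => /eqP.
have: y \in image_pred f by rewrite eqI.
by case/asboolP=> z ->; exists z.
Qed.

(** A nonzero map to a simple projective module splits. *)
Lemma simple_projective_summand M P (f : {linear M -> P}) (x : M) :
  simple_module P -> projective P -> f x <> 0 -> direct_summand P M.
Proof.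
move=> simP projP fx.
have l1 : linear (fun y : P => y) by [].
have [s sK] := projP _ _ f (linear_map l1) (simple_surjective simP fx).
exact: (split_epi_summand sK).
Qed.

(** If the regular module is basic, then [Hom(q, p) = 0] for a decomposition
    into a simple module [p] and a complement [q]: a nonzero map would make
    [p] a summand of [q], and [p] would occur twice in the regular module. *)
Lemma basic_Hom_complement (p q : lmodType R) :
  basic R^o -> simple_module p -> projective p ->
  isomorphic R^o (p * q)%type -> forall (f : {linear q -> p}) x, f x = 0.
Proof.
move=> basR simp projp Rpq f x; apply: contrapT => fx.
have [q' qpq'] := simple_projective_summand simp projp fx.
have /basR zp : direct_summand (p * p)%type R^o.
  exists q'; apply: (isomorphic_trans Rpq).
  apply: isomorphic_trans (isomorphic_sym (isomorphic_prodA _ _ _)).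
  exact: isomorphic_prod (isomorphic_refl _) qpq'.
by case: simp => + _; apply; move=> y; exact: zp.
Qed.

End Modules.

(** * Maps from a transpose to a simple projective module *)

(** The dual basis of a finitely generated projective module. *)
Lemma dual_basis (R : nzRingType) (P : fgmod R) : projective P ->
  exists (m : nat) (g : 'I_m -> P) (f : 'I_m -> {linear P -> R^o}),
    forall x, x = \sum_i f i x *: g i.
Proof.
move=> projP; have [m [g gen]] := fgmod_fg P.
have le : linear (fun c : {ffun 'I_m -> R^o} => \sum_i (c i : R) *: g i).
  move=> a c d; rewrite scaler_sumr -big_split; apply: eq_bigr => i _ /=.
  by rewrite !ffunE scalerDl scalerA.
have l1 : linear (fun y : P => y) by [].
have [x|s sK] := projP _ _ (linear_map le) (linear_map l1).
  have [c ->] := gen x; exists [ffun i => c i].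
  by apply: eq_bigr => i _; rewrite ffunE.
have lf i : linear (fun x : P => s x i : R^o).
  by move=> a x y; rewrite linearP !ffunE.
by exists m, g, (fun i => linear_map (lf i)) => x; rewrite -[LHS]sK.
Qed.

Lemma lin_hom_sum (R : nzRingType) (M N : lmodType R) (I : Type) (r : seq I)
    (F : I -> lin_hom M N) (x : M) :
  (\sum_(i <- r) F i : lin_hom M N) x = \sum_(i <- r) F i x.
Proof. by elim: r => [|i r IHr]; rewrite ?big_nil // !big_cons -IHr. Qed.

(** A finitely generated projective right module is reflexive; here, every
    linear form on its dual is an evaluation. *)
Lemma ring_dual_form (R : nzRingType) (P : fgmod R^c)
    (phi : {linear ring_dual P -> R^o}) : projective P ->
  exists x : P, forall f : ring_dual P, phi f = f x.
Proof.
move=> /dual_basis [m [g [f basis]]].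
exists (\sum_i (phi (f i : ring_dual P) : R^c) *: g i) => h.
have {1}-> : h = \sum_i (h (g i) : R) *: (f i : ring_dual P).
  apply: lin_homP => y; rewrite {1}[y]basis linear_sum.
  rewrite (@lin_hom_sum R^c P (R^c)^o).
  by apply: eq_bigr => i _; rewrite linearZ.
by rewrite !linear_sum; apply: eq_bigr => i _; rewrite !linearZ.
Qed.

(** The transpose [Y] of [X], being computed from a minimal presentation
    [d : P1 -> P0], has no nonzero map to a simple projective module [p]: such
    a map, composed with an embedding of [p] into the regular module, is the
    evaluation at some [x] in [P1] with [d x = 0], and [x] generates a direct
    summand of [P1]; but the kernel of [d] is superfluous. *)
Lemma transpose_Hom_simple (R : nzRingType) (X : lmodType R^c)
    (Y p q : lmodType R) :
  is_transpose X Y -> simple_module p -> isomorphic R^o (p * q)%type ->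
  forall (f : {linear Y -> p}) y, f y = 0.
Proof.
move=> [P1 [P0 [d [_ [c [[projP1 projP0 _ _ superd] [csurj cexact]]]]]]].
move=> simp [al [be alK beK]] f y0; apply: contrapT => fy0.
pose lbe := linear_map (linear_inverse alK beK).
pose iota := linear_map (linear_comp lbe (linear_map (@inl_linear R p q))).
(* The idempotent of the summand [p]: the projection onto it is [r |-> r * e]. *)
pose e : R := iota (al 1).1.
have iotaE (r : R) : iota (al r).1 = r * e.
  have -> : al r = r *: al 1.
    by rewrite -linearZ; congr (al _); rewrite [RHS]mulr1.
  by rewrite -[LHS]/(iota (r *: (al 1).1)) linearZ.
have iota1 z : (al (iota z)).1 = z.
  by rewrite /iota /= /linear_fun /= /linear_fun beK.
have ee : e * e = e by rewrite -iotaE iota1.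
have e0 : e <> 0.
  move=> e0; case: simp => + _; apply => z.
  rewrite -[LHS]iota1; have -> : iota z = 0.
    by rewrite -[z]iota1 iotaE e0 mulr0.
  by rewrite linear0.
have [y fy] := simple_surjective simp fy0 (al 1).1.
have [g cg] := csurj y.
pose phi := linear_map
  (linear_comp (linear_map (linear_comp iota f)) c).
have [x phiE] := ring_dual_form phi projP1.
have gx : g x = e by rewrite -phiE /phi /= /linear_fun /= /linear_fun cg fy.
have dx : d x = 0.
  have [m [h [b basis]]] := dual_basis projP0.
  rewrite [LHS]basis big1 // => i _.
  have -> : b i (d x) = 0; last exact: scale0r.
  rewrite -[LHS](phiE (ring_dual_map d (b i : ring_dual P0))).
  rewrite -[LHS]/(iota (f (c (ring_dual_map d (b i : ring_dual P0))))).
  have -> : c (ring_dual_map d (b i : ring_dual P0)) = 0.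
    by apply/cexact; exists (b i).
  by rewrite !linear0.
(* [x] generates the direct summand of [P1] that is complementary to [S]. *)
pose S : {pred P1} := fun z => e * (g z : R) == 0.
have subS : submod_closed S.
  split=> [|a u v]; rewrite /S unfold_in.
    by rewrite linear0 mulr0.
  move=> /eqP gu /eqP gv; rewrite unfold_in linearP mulrDr gv addr0.
  (* Scaling by [a] in the opposite ring is multiplication on the right. *)
  have -> : e * ((a *: (g u : (R^c)^o) : (R^c)^o) : R) =
      e * (g u : R) * (a : R) by exact: mulrA.
  by rewrite gu mul0r.
have ST : S =i predT.
  apply: superd subS _ => z; pose r : R^c := e * (g z : R).
  exists (z - r *: x), (r *: x); split; last by rewrite subrK.
    have -> : (z - r *: x \in S) = (e * (g (z - r *: x) : R) == 0) by [].
    rewrite linearB mulrBr.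
    have -> : (g (r *: x) : R) = e * r by rewrite linearZ -gx.
    by rewrite /r !mulrA !ee subrr.
  by rewrite linearZ dx; exact: scaler0.
have := ST x; rewrite unfold_in /S gx ee => /eqP; exact: e0.
Qed.

(** * Splitting off the copies of a simple projective module *)

Section Splitting.
Variables (R : nzRingType) (M p : lmodType R) (V : {pred M}).
Hypothesis submodV : submod_closed V.

(** [M] is the sum of the submodule [V] and the images of the [h i]. *)
Definition spanning (a : nat) (h : 'I_a -> {linear p -> M}) : Prop :=
  forall x, exists (y : M) (z : {ffun 'I_a -> p}),
    y \in V /\ x = y + sum_map h z.

(** A relation with nonzero [j]-th coordinate makes [h j] superfluous when [p]
    is simple. *)
Lemma spanning_lift (a : nat) (h : 'I_a.+1 -> {linear p -> M}) (j : 'I_a.+1)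
    (y : M) (z : {ffun 'I_a.+1 -> p}) :
  simple_module p -> spanning h -> y \in V -> y + sum_map h z = 0 ->
  z j <> 0 -> spanning (fun i => h (lift j i)).
Proof.
case: submodV => V0 VP.
have VD u v : u \in V -> v \in V -> u + v \in V.
  by move=> Vu Vv; rewrite -[u]scale1r; apply: VP.
have VN u : u \in V -> - u \in V.
  by move=> Vu; rewrite -scaleN1r -[_ *: _]addr0; apply: VP.
move=> [_ simp] sph Vy yz0 zj.
(* The [w] whose image under [h j] is already in the span of the others. *)
pose S : {pred p} := fun w => `[< exists (v : M) (c : {ffun 'I_a -> p}),
  v \in V /\ h j w = v + sum_map (fun i => h (lift j i)) c >].
have subS : submod_closed S.
  split=> [|b u v].
    by apply/asboolP; exists 0, 0; rewrite !linear0 addr0.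
  case/asboolP=> u' [c [Vu' hu]] /asboolP [v' [d [Vv' hv]]].
  apply/asboolP; exists (b *: u' + v'), (b *: c + d); split; first exact: VP.
  by rewrite linearP hu hv linearP scalerDr addrACA.
have ST : S =i predT.
  case: (simp S subS) => // S0; suff: z j \in S by rewrite S0 => /eqP.
  apply/asboolP; exists (- y), (- [ffun i => z (lift j i)]).
  split; first exact: VN.
  apply/eqP; rewrite linearN -opprD -addr_eq0 addrCA -sum_map_lift.
  exact/eqP.
move=> x; have [v [c [Vv ->]]] := sph x.
have /asboolP [w [d [Vw hw]]] : c j \in S by rewrite ST.
exists (v + w), (d + [ffun i => c (lift j i)]); split; first exact: VD.
by rewrite (sum_map_lift h j) hw linearD -!addrA.
Qed.

(** A spanning family of the least size spans a direct complement of [V]. *)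
Lemma spanning_complement (a : nat) (h : 'I_a -> {linear p -> M}) :
  simple_module p -> spanning h ->
  exists b : nat,
    isomorphic M (submodule submodV * {ffun 'I_b -> p})%type.
Proof.
move=> simp sph.
pose Q b := `[< exists f : 'I_b -> {linear p -> M}, spanning f >].
have exQ : exists b, Q b by exists a; apply/asboolP; exists h.
case: (ex_minnP exQ) => b /asboolP [f spf] bmin {a h sph exQ}.
exists b; apply: isomorphic_sym.
have lF : linear (fun w : submodule submodV * {ffun 'I_b -> p} =>
    val w.1 + sum_map f w.2).
  by move=> c u v; rewrite /= linearP scalerDr addrACA.
have injF w : linear_map lF w = 0 -> w = 0.
  case: w => y z /= yz0; have {}yz0 : val y + sum_map f z = 0 := yz0.
  have z0 : z = 0.
    apply/ffunP => j; rewrite ffunE; apply: contrapT => zj.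
    case: b f spf bmin j z zj yz0 {lF} => [|b] f spf bmin j z zj yz0.
      by case: j zj.
    have spl := spanning_lift simp spf (valP y) yz0 zj.
    have /bmin : Q b by apply/asboolP; exists (fun i => f (lift j i)).
    by rewrite ltnn.
  move: yz0; rewrite z0 linear0 addr0 => y0.
  by congr pair; apply: val_inj.
have surjF x : exists w, linear_map lF w = x.
  have [y [z [Vy ->]]] := spf x.
  by exists (Submodule (Vy : y \in submodule_pred submodV), z).
have [G GK] := boolp.choice surjF.
exists (linear_map lF), G => // w; apply/eqP; rewrite -subr_eq0; apply/eqP.
by apply: injF; rewrite linearB GK subrr.
Qed.

End Splitting.

(** If the regular module is [p * q] with [p] simple, then a finitely
    generated module is the direct sum of a quotient of some [q ^ r] and some
    [p ^ a]. *)
Lemma simple_summand_decomposition (R : nzRingType) (p q : lmodType R)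
    (m : fgmod R) :
  simple_module p -> isomorphic R^o (p * q)%type ->
  exists (u : lmodType R) (a r : nat) (F : {linear {ffun 'I_r -> q} -> u}),
    isomorphic m (u * {ffun 'I_a -> p})%type /\ surjective F.
Proof.
move=> simp [al [be alK beK]]; have [r [g gen]] := fgmod_fg m.
pose lbe := linear_map (linear_inverse alK beK).
have lg i : linear (fun x : R^o => (x : R) *: g i).
  by move=> c x y; rewrite scalerDl scalerA.
pose lgbe i := linear_map (linear_comp (linear_map (lg i)) lbe).
pose f i := linear_map (linear_comp (lgbe i) (linear_map (@inl_linear R p q))).
pose h i := linear_map (linear_comp (lgbe i) (linear_map (@inr_linear R p q))).
pose H := sum_map h.
have subH := image_submod_closed H.
have spf : spanning (image_pred H) f.
  move=> x; have [c ->] := gen x.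
  exists (H [ffun i => (al (c i)).2]), [ffun i => (al (c i)).1].
  split; first by apply/asboolP; exists [ffun i => (al (c i)).2].
  rewrite !sum_mapE -big_split.
  apply: eq_bigr => i _; rewrite !ffunE.
  rewrite -[RHS]/(lgbe i (0, (al (c i)).2) + lgbe i ((al (c i)).1, 0)) -linearD.
  rewrite addrC pair_decomposition.
  by rewrite -[RHS]/((be (al (c i)) : R) *: g i) alK.
have [a iso] := spanning_complement subH simp spf.
have HV x : H x \in submodule_pred subH by apply/asboolP; exists x.
have lF : linear (fun x => Submodule (HV x)).
  by move=> c x y; apply: val_inj; rewrite /= linearP.
exists (submodule subH), a, r, (linear_map lF); split=> // y.
have /asboolP [x yE] := valP y; exists x.
by apply: val_inj; rewrite /= -yE.
Qed.

Lemma finitely_generated_quotient (R : nzRingType) (M N : lmodType R)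
    (f : {linear M -> N}) :
  surjective f -> finitely_generated M -> finitely_generated N.
Proof.
move=> fsurj [m [g gen]]; exists m, (fun i => f (g i)) => y.
have [x <-] := fsurj y; have [c ->] := gen x; exists c.
by rewrite linear_sum; apply: eq_bigr => i _; rewrite linearZ.
Qed.

(** * The torsion sequence of a direct sum decomposition *)

Section SplitSequence.
Variables (R : nzRingType) (T U : fgmod R -> Prop).

(** The sequence [v -> z -> z -> ...] with zero maps, for a zero module [z]. *)
Definition stalk (v z : fgmod R) : mseq R :=
  let ob i := if i is 0 then v else z in
  @MSeq R ob (fun i => (\0 : {linear ob i -> ob i.+1})).

Variables (m u v z : fgmod R).
Variables (theta : {linear u -> m}) (rho : {linear m -> u}).
Variables (pi : {linear m -> v}) (sigma : {linear v -> m}).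
Hypotheses (rhoK : cancel theta rho) (piK : cancel sigma pi).
Hypothesis pi_theta : forall x, pi (theta x) = 0.
Hypothesis decomposition : forall x, theta (rho x) + sigma (pi x) = x.
Hypotheses (Tm : T m) (Tu : T u) (Tv : T v) (Tz : T z).
Hypothesis z0 : zero_module z.

(** A short split exact sequence, continued by zero modules. *)
Lemma split_n_exact (n : nat) :
  n_exact n.+1 T
    (@mseq_cons R u
      (@mseq_cons R m (stalk v z) (pi : {linear m -> stalk v z 0})) theta).
Proof.
split.
- by case=> [|[|[|i]]].
- by move=> w _ f /= f0 x; rewrite -[LHS]rhoK f0 linear0.
- move=> w _ [|[|i]] _ f; split.
  + move=> f0; exists (linear_map (linear_comp rho f)) => x.
    rewrite -{1}[f x]decomposition; have /= -> := f0 x.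
    by rewrite linear0 addr0.
  + by move=> [g fg] x; rewrite fg; exact: pi_theta.
  + move=> _; exists (linear_map (linear_comp sigma f)) => x.
    by rewrite /= /linear_fun piK.
  + by [].
  + by move=> _; exists \0 => x; exact: z0.
  + by [].
- case: n => [|n] w _ f f0 x; last by rewrite [x]z0 linear0.
  by rewrite -[x]piK; exact: f0.
- move=> w _ [|[|i]] _ f; split.
  + move=> f0; exists (linear_map (linear_comp f sigma)) => x.
    by rewrite -{1}[x]decomposition linearD f0 add0r.
  + by move=> [g fg] x; rewrite fg /= pi_theta linear0.
  + move=> f0; exists \0 => x; rewrite -[x]piK; exact: f0.
  + by move=> [g fg] x; rewrite fg /= linear0.
  + by move=> _; exists \0 => x; rewrite [x]z0 linear0.
  + by move=> _ x; rewrite /= linear0.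
Qed.

Lemma split_torsion_sequence (n : nat) : U u ->
  (forall w, U w -> forall (f : {linear w -> v}) x, f x = 0) ->
  torsion_sequence n.+1 T U theta.
Proof.
move=> Uu Uv; exists (stalk v z), pi; split=> //; last exact: split_n_exact.
split.
- by case.
- by [].
- by move=> w Uw f _; exact: Uv.
- by move=> w _ i _ f _; exists \0 => x; exact: z0.
Qed.

End SplitSequence.

(** * The classes [add] and [Fac] *)

Section AddClosure.
Variables (R : nzRingType).
Implicit Types M t x y : fgmod R.

Lemma add_closure_summand M x y :
  direct_summand y x -> add_closure M x -> add_closure M y.
Proof.
move=> yx [d xM]; exists d; exact: direct_summand_trans yx xM.
Qed.

Lemma Fac_quotient t x y (f : {linear x -> y}) :
  surjective f -> Fac t x -> Fac t y.
Proof.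
move=> fsurj [d [g gsurj]]; exists d, (linear_map (linear_comp f g)) => b.
have [a <-] := fsurj b; have [c <-] := gsurj a.
by exists c.
Qed.

Lemma surjective_power (M N : lmodType R) (f : {linear M -> N}) (d : nat) :
  surjective f ->
  exists g : {linear {ffun 'I_d -> M} -> {ffun 'I_d -> N}}, surjective g.
Proof.
move=> fsurj.
have lg : linear (fun c : {ffun 'I_d -> M} => [ffun i => f (c i)]).
  by move=> a b c; apply/ffunP => i; rewrite !ffunE linearP.
exists (linear_map lg) => y; have [s sK] := boolp.choice fsurj.
by exists [ffun i => s (y i)]; apply/ffunP => i; rewrite !ffunE sK.
Qed.

(** [Hom(t, p) = 0] passes to quotients of powers of [t] and powers of [p]. *)
Lemma Fac_Hom_power t x (p : lmodType R) (a : nat) :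
  (forall (f : {linear t -> p}) b, f b = 0) -> Fac t x ->
  forall (f : {linear x -> {ffun 'I_a -> p}}) b, f b = 0.
Proof.
move=> tp [d [g gsurj]] f b; have [c <-] := gsurj b.
apply/ffunP => j; rewrite ffunE.
have le i : linear (fun y : fgmod_sort t => [ffun l => if l == i then y else 0]
    : {ffun 'I_d -> t}).
  move=> s y y'; apply/ffunP => l; rewrite !ffunE.
  by case: eqP; rewrite ?scaler0 ?addr0.
have lj : linear (fun y : {ffun 'I_a -> p} => y j).
  by move=> s y y'; rewrite !ffunE.
have -> : c = \sum_i linear_map (le i) (c i).
  apply/ffunP => l; rewrite sum_ffunE (bigD1 l) //= ffunE eqxx big1 ?addr0 //.
  by move=> i /negbTE il; rewrite ffunE eq_sym il.
rewrite !linear_sum sum_ffunE big1 // => i _.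
exact: (tp (linear_map (linear_comp (linear_map lj) (linear_map
  (linear_comp f (linear_map (linear_comp g (linear_map (le i))))))))).
Qed.

End AddClosure.

(** * Splitting torsion sequences from a simple summand of the regular module *)

Section Main.
Variable R : nzRingType.

(** If [t] is the direct sum of a transpose and a complement [q] of the simple
    projective [p], then [Hom(t, p) = 0]. *)
Lemma Hom_transpose_complement (X : lmodType R^c) (t x p q : lmodType R) :
  basic R^o -> simple_module p -> projective p -> isomorphic R^o (p * q)%type ->
  is_transpose X x -> isomorphic t (x * q)%type ->
  forall (f : {linear t -> p}) y, f y = 0.
Proof.
move=> basR simp projp Rpq trx /isomorphic_sym [g [h gK hK]] f y.
rewrite -[y]hK -[h y]pair_decomposition !linearD.
pose fg := linear_map (linear_comp f g).
rewrite [X in X + _](transpose_Hom_simple trx simp Rpq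
  (linear_map (linear_comp fg (linear_map (@inl_linear _ x q)))) _) add0r.
exact: (basic_Hom_complement basR simp projp Rpq
  (linear_map (linear_comp fg (linear_map (@inr_linear _ x q))))).
Qed.

(** If [q] is a quotient of [t] and [Hom(t, p) = 0], then the decomposition of
    [m] into a quotient of [q ^ r] and a power [p ^ a] gives a split torsion
    sequence. *)
Lemma split_torsion_sequence_exists (M t m : fgmod R) (p q : lmodType R)
    (g : {linear t -> q}) (n : nat) :
  simple_module p -> isomorphic R^o (p * q)%type -> surjective g ->
  (forall (f : {linear t -> p}) y, f y = 0) -> add_closure M m ->
  exists (u : fgmod R) (theta : {linear u -> m}),
    torsion_sequence n.+1 (add_closure M)
      (fun w => add_closure M w /\ Fac t w) theta
    /\ split_mono theta.
Proof.
move=> simp Rpq gsurj tp Mm.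
have [u [a [r [F [mua Fsurj]]]]] := simple_summand_decomposition m simp Rpq.
have [phi [psi phiK psiK]] := mua.
pose lpsi := linear_map (linear_inverse phiK psiK).
pose rho := linear_map (linear_comp (linear_map (@fst_linear _ _ _)) phi).
pose pi := linear_map (linear_comp (linear_map (@snd_linear _ _ _)) phi).
pose theta := linear_map (linear_comp lpsi (linear_map
  (@inl_linear _ u {ffun 'I_a -> p}))).
pose sigma := linear_map (linear_comp lpsi (linear_map
  (@inr_linear _ u {ffun 'I_a -> p}))).
have rhoK : cancel theta rho.
  by move=> y; rewrite -[LHS]/(phi (psi (y, 0))).1 psiK.
have piK : cancel sigma pi.
  by move=> y; rewrite -[LHS]/(phi (psi (0, y))).2 psiK.
have pi_theta y : pi (theta y) = 0.
  by rewrite -[LHS]/(phi (psi (y, 0))).2 psiK.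
have dec y : theta (rho y) + sigma (pi y) = y.
  rewrite -[LHS]/(lpsi ((phi y).1, 0) + lpsi (0, (phi y).2)) -linearD.
  rewrite pair_decomposition; exact: phiK.
have ufg : finitely_generated u.
  apply: (finitely_generated_quotient (f := rho)) (fgmod_fg m) => y.
  by exists (theta y).
have vfg : finitely_generated {ffun 'I_a -> p}.
  apply: (finitely_generated_quotient (f := pi)) (fgmod_fg m) => y.
  by exists (sigma y).
have z0 : zero_module {ffun 'I_0 -> R^o}.
  by move=> y; apply/ffunP => -[].
have zfg : finitely_generated {ffun 'I_0 -> R^o}.
  exists 0%N, (fun _ => 0) => y; exists (fun _ => 0); rewrite big_ord0.
  exact: z0.
exists (FGMod ufg), theta; split; last by exists rho.
have Mu : add_closure M (FGMod ufg).
  by apply: add_closure_summand Mm; exists {ffun 'I_a -> p}.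
apply: (@split_torsion_sequence _ _ _ m (FGMod ufg) (FGMod vfg) (FGMod zfg)
  theta rho pi sigma) => //.
- apply: add_closure_summand Mm; exists u.
  exact: isomorphic_trans mua (isomorphic_prodC _ _).
- apply: add_closure_summand Mm; exists m.
  have lz : linear (fun y : m => (0, y) : {ffun 'I_0 -> R^o} * m).
    exact: inr_linear.
  exists (linear_map lz), snd => // -[w y].
  by congr pair; exact/esym/z0.
- split=> //.
  have [gr grsurj] := surjective_power r gsurj.
  exists r, (linear_map (linear_comp F gr)) => y.
  have [b <-] := Fsurj y; have [c <-] := grsurj b; by exists c.
- by move=> w [_ Fw]; exact: Fac_Hom_power tp Fw.
Qed.

End Main.

Theorem theorem0p5 (k : closedFieldType) (A : falgType k) (n : nat)
    (M t : fgmod A) :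
  (1 <= n)%N ->
  basic A^o -> basic M ->
  n_cluster_tilting n (add_closure M) ->
  gldim_le A n ->
  nAPR_tilting n t ->
  splitting_torsion_class n (add_closure M) (fun x => add_closure M x /\ Fac t x).
Proof.
case: n => // n _ basA _ _ _.
move=> [p [q [x [[simp projp _] Apq [Y [_ trY]] txq]]]].
have tp := Hom_transpose_complement basA simp projp Apq trY txq.
have [g gsurj] : exists g : {linear t -> q}, surjective g.
  have [f [h _ hK]] := txq.
  exists (linear_map (linear_comp (linear_map (@snd_linear _ _ _)) f)) => y.
  by exists (h (0, y)); rewrite /= /linear_fun hK.
have key m := split_torsion_sequence_exists (m := m) n simp Apq gsurj tp.
split; last by move=> m /key.
split.
- move=> y y' yy' [My Fy]; split.
    (* An isomorphic copy is a direct summand with zero complement. *)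
    apply: add_closure_summand My; exists {ffun 'I_0 -> A^o}.
    apply: isomorphic_trans yy' _.
    have li := @inl_linear _ y' {ffun 'I_0 -> A^o}.
    exists (linear_map li), fst => // -[w z].
    by congr pair; apply/ffunP => -[].
  case: yy' => f [f' _ f'K].
  by apply: (Fac_quotient (f := f)) Fy => b; exists (f' b).
- by move=> y [].
- by move=> m /key [u [theta [seq _]]]; exists u, theta.
Qed.
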